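(* Let $\mathsf{i}:\mathsf{IF}\to\mathsf{MF}$ be the inclusion functor. Then the category $\mathsf{IF_{\Box}}$ of $\Box$-frames and $\Box$-frame morphisms is isomorphic to $\mathsf{Dialg}(\mathsf{i},\mathsf{G})$.
   Context: $\mathsf{MF}$: meet-semilattices with top (viewed as posets) and maps preserving finite meets. An I-frame is a poset $(X,\leq)$ that is an implicative meet-semilattice with top; an I-frame morphism is a finite-meet-preserving map $f$ such that $f(x)\leq' y'$ implies $\exists y\geq x$ with $f(y)=y'$; these form $\mathsf{IF}$. A filter is a non-empty up-closed subset closed under finite meets. $\mathsf{G}:\mathsf{IF}\to\mathsf{MF}$ sends $(X,\leq)$ to the set of its filters ordered by reverse inclusion, with top $\{\top\}$ and meet $a \sqcap b = \{x\wedge y \mid x\in a, y\in b\}$, and sends a morphism $h$ to $a\mapsto h[a]$. For functors $\mathsf{F},\mathsf{H}:\mathsf{C}\to\mathsf{D}$, $\mathsf{Dialg}(\mathsf{F},\mathsf{H})$ has objects $(X,\gamma)$ with $X\in\mathsf{C}$ and $\gamma:\mathsf{F}X\to\mathsf{H}X$ in $\mathsf{D}$, and morphisms $f:X\to X'$ in $\mathsf{C}$ with $\mathsf{H}f\circ\gamma=\gamma'\circ\mathsf{F}f$. A $\Box$-frame is $(X,\leq,R)$ with $(X,\leq)$ an I-frame and $R$ a relation with (B1) $\top Rx$ iff $x=\top$, and $xR\top$ for all $x$; (B2) $xRy\leq z$ implies $xRz$; (B3) $xRy$, $x'Ry'$ imply $(x\wedge x')R(y\wedge y')$; (B4) $(x\wedge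 x')Rz$ implies $\exists y,y'$ with $xRy$, $x'Ry'$, $y\wedge y'=z$. A $\Box$-frame morphism is an I-frame morphism $h$ such that $xRy$ implies $h(x)R'h(y)$ and $h(x)R'y'$ implies $\exists y$ with $xRy$, $h(y)=y'$. *)

(* Defs.v *)
From HB Require Import structures.
From mathcomp Require Import all_boot all_order.
From mathcomp Require Import boolp classical_sets.

Set Implicit Arguments.
Unset Strict Implicit.
Unset Printing Implicit Defensive.

Import Order.TTheory.
Local Open Scope classical_set_scope.
Local Open Scope order_scope.

Lemma sval_eq (T : Type) (P : T -> Prop) (u v : {x | P x}) :
  sval u = sval v -> u = v.
Proof. by case: u v => [x p] [y q] /= xy; apply: eq_exist. Qed.

Record category := Category {
  obj :> Type;
  hom : obj -> obj -> Type;
  idm : forall X, hom X X;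
  compm : forall X Y Z, hom Y Z -> hom X Y -> hom X Z;
  comp1m : forall X Y (f : hom X Y), compm (idm Y) f = f;
  compm1 : forall X Y (f : hom X Y), compm f (idm X) = f;
  compmA : forall X Y Z W (h : hom Z W) (g : hom Y Z) (f : hom X Y),
    compm h (compm g f) = compm (compm h g) f
}.
Arguments hom {c} X Y.
Arguments idm {c} X.
Arguments compm {c X Y Z} g f.

Record functor (C D : category) := Functor {
  fobj :> C -> D;
  fmap : forall X Y : C, hom X Y -> hom (fobj X) (fobj Y);
  fmap1 : forall X, fmap (idm X) = idm (fobj X);
  fmapM : forall X Y Z (g : hom Y Z) (f : hom X Y),
    fmap (compm g f) = compm (fmap g) (fmap f)
}.
Arguments fmap {C D} F {X Y} f : rename.

Section FunctorCategory.
Variables C D E : category.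

Definition functor_id : functor C C :=
  @Functor C C (fun X => X) (fun X Y f => f)
    (fun=> erefl) (fun _ _ _ _ _ => erefl).

Variables (G : functor D E) (F : functor C D).

Lemma functor_comp_map1 (X : C) : fmap G (fmap F (idm X)) = idm (G (F X)).
Proof. by rewrite !fmap1. Qed.

Lemma functor_comp_mapM (X Y Z : C) (g : hom Y Z) (f : hom X Y) :
  fmap G (fmap F (compm g f)) =
  compm (fmap G (fmap F g)) (fmap G (fmap F f)).
Proof. by rewrite !fmapM. Qed.

Definition functor_comp : functor C E :=
  @Functor C E (fun X => G (F X)) (fun X Y f => fmap G (fmap F f))
    functor_comp_map1 functor_comp_mapM.

End FunctorCategory.

(* Strict isomorphism, not equivalence: the composites are equal to the identity
   functors, not just naturally isomorphic to them. *)
Definition isomorphic_categories (C D : category) : Prop :=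
  exists (F : functor C D) (G : functor D C),
    functor_comp G F = functor_id C /\ functor_comp F G = functor_id D.

Section Dialgebras.
Variables (C D : category) (F H : functor C D).

Record dialgebra := Dialgebra {
  dialg_obj :> C;
  dialg_str : hom (F dialg_obj) (H dialg_obj)
}.

Definition is_dialg_hom (A B : dialgebra) (f : hom (dialg_obj A) (dialg_obj B)) :
  Prop := compm (fmap H f) (dialg_str A) = compm (dialg_str B) (fmap F f).

Definition dialg_hom (A B : dialgebra) := {f | @is_dialg_hom A B f}.

Lemma dialg_id_subproof (A : dialgebra) : @is_dialg_hom A A (idm _).
Proof. by rewrite /is_dialg_hom !fmap1 comp1m compm1. Qed.

Lemma dialg_comp_subproof (A B K : dialgebra)
    (g : dialg_hom B K) (f : dialg_hom A B) :
  @is_dialg_hom A K (compm (sval g) (sval f)).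
Proof.
case: g f => [g hg] [f hf]; rewrite /is_dialg_hom /= !fmapM.
by rewrite -compmA hf compmA hg compmA.
Qed.

Definition dialg_id (A : dialgebra) : dialg_hom A A :=
  exist _ _ (dialg_id_subproof A).

Definition dialg_comp (A B K : dialgebra)
    (g : dialg_hom B K) (f : dialg_hom A B) : dialg_hom A K :=
  exist _ _ (dialg_comp_subproof g f).

Lemma dialg_comp1m A B (f : dialg_hom A B) : dialg_comp (dialg_id B) f = f.
Proof. by apply: sval_eq; rewrite /= comp1m. Qed.

Lemma dialg_compm1 A B (f : dialg_hom A B) : dialg_comp f (dialg_id A) = f.
Proof. by apply: sval_eq; rewrite /= compm1. Qed.

Lemma dialg_compmA A B K L (h : dialg_hom K L) (g : dialg_hom B K)
    (f : dialg_hom A B) :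
  dialg_comp h (dialg_comp g f) = dialg_comp (dialg_comp h g) f.
Proof. by apply: sval_eq; rewrite /= compmA. Qed.

Definition Dialg : category := Category dialg_comp1m dialg_compm1 dialg_compmA.

End Dialgebras.

Section ConcreteCategory.
Variables (T : Type) (car : T -> Type).
Variable P : forall X Y : T, (car X -> car Y) -> Prop.
Arguments P : clear implicits.
Hypothesis P_id : forall X, P X X id.
Hypothesis P_comp : forall X Y Z (g : car Y -> car Z) (f : car X -> car Y),
  P Y Z g -> P X Y f -> P X Z (g \o f).

Definition concrete_hom (X Y : T) := {f | P X Y f}.

Definition concrete_id (X : T) : concrete_hom X X := exist _ id (P_id X).

Definition concrete_comp (X Y Z : T)
    (g : concrete_hom Y Z) (f : concrete_hom X Y) : concrete_hom X Z :=
  exist _ (sval g \o sval f) (P_comp (svalP g) (svalP f)).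

Lemma concrete_comp1m X Y (f : concrete_hom X Y) :
  concrete_comp (concrete_id Y) f = f.
Proof. exact: sval_eq. Qed.

Lemma concrete_compm1 X Y (f : concrete_hom X Y) :
  concrete_comp f (concrete_id X) = f.
Proof. exact: sval_eq. Qed.

Lemma concrete_compmA X Y Z W (h : concrete_hom Z W) (g : concrete_hom Y Z)
    (f : concrete_hom X Y) :
  concrete_comp h (concrete_comp g f) = concrete_comp (concrete_comp h g) f.
Proof. exact: sval_eq. Qed.

Definition concrete_category : category :=
  Category concrete_comp1m concrete_compm1 concrete_compmA.

End ConcreteCategory.

Definition msl_display : Order.disp_t := Order.Disp tt tt.

(* The display only steers notations ([Order.disp_t] has a single element), so
   fixing it is no restriction on the semilattices considered. Nor is the
   [choiceType] carrier of the library's ordered types: by the axioms of boolp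
   every type has such a structure. *)
Notation msl := (tMeetSemilatticeType msl_display).

Definition msl_sort (X : msl) : Type := X.

Definition is_msl_hom (X Y : msl) (f : X -> Y) : Prop :=
  f \top = \top /\ {morph f : x y / x `&` y}.

Lemma is_msl_hom_id (X : msl) : @is_msl_hom X X id.
Proof. by []. Qed.

Lemma is_msl_hom_comp (X Y Z : msl) (g : Y -> Z) (f : X -> Y) :
  is_msl_hom g -> is_msl_hom f -> is_msl_hom (g \o f).
Proof. by move=> [g1 gI] [f1 fI]; split=> [|x y] /=; rewrite ?f1 // fI gI. Qed.

Definition MF : category :=
  @concrete_category msl msl_sort is_msl_hom is_msl_hom_id is_msl_hom_comp.

Record iFrame := IFrame {
  iframe_msl :> msl;
  iframe_imp : forall x y : iframe_msl,
    exists z, forall w, (w <= z) <-> (w `&` x <= y)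
}.

Definition iframe_sort (X : iFrame) : Type := X.

Definition is_iframe_hom (X Y : iFrame) (f : X -> Y) : Prop :=
  is_msl_hom f /\
  forall (x : X) (y' : Y), f x <= y' -> exists2 y : X, x <= y & f y = y'.

Lemma is_iframe_hom_id (X : iFrame) : @is_iframe_hom X X id.
Proof. by split=> // x y xy; exists y. Qed.

Lemma is_iframe_hom_comp (X Y Z : iFrame) (g : Y -> Z) (f : X -> Y) :
  is_iframe_hom g -> is_iframe_hom f -> is_iframe_hom (g \o f).
Proof.
move=> [g1 g2] [f1 f2]; split; first exact: is_msl_hom_comp.
by move=> x z /g2[_ /f2[y xy <-] <-]; exists y.
Qed.

Definition IF : category :=
  @concrete_category iFrame iframe_sort is_iframe_hom
    is_iframe_hom_id is_iframe_hom_comp.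

Definition IF_incl_map (X Y : IF) (f : hom X Y) :
    @hom MF (iframe_msl X) (iframe_msl Y) :=
  exist _ (sval f) (proj1 (svalP f)).

Lemma IF_incl_map1 (X : IF) : IF_incl_map (idm X) = @idm MF (iframe_msl X).
Proof. exact: sval_eq. Qed.

Lemma IF_incl_mapM (X Y Z : IF) (g : hom Y Z) (f : hom X Y) :
  IF_incl_map (compm g f) = @compm MF _ _ _ (IF_incl_map g) (IF_incl_map f).
Proof. exact: sval_eq. Qed.

Definition IF_incl : functor IF MF :=
  @Functor IF MF iframe_msl IF_incl_map IF_incl_map1 IF_incl_mapM.

(* The empty meet \top belongs to every non-empty up-closed set, so binary
   meets suffice in the last clause. *)
Definition is_filter (X : iFrame) (a : set X) : Prop :=
  [/\ a !=set0,
      forall x y : X, a x -> x <= y -> a y &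
      forall x y : X, a x -> a y -> a (x `&` y)].

Record filters (X : iFrame) := MkFilter {
  filter_set :> set X;
  filter_setP : is_filter filter_set
}.

Lemma filters_inj (X : iFrame) (a b : filters X) :
  (a : set X) = b -> a = b.
Proof. by case: a b => [a ha] [b hb] /= ab; case: _ / ab hb => hb; congr MkFilter. Qed.

Section FilterSemilattice.
Variable X : iFrame.
Implicit Types a b c : filters X.

Definition filter_le a b : bool := `[< (b : set X) `<=` a >].

Lemma filter_le_refl : reflexive filter_le.
Proof. by move=> a; apply/asboolP. Qed.

Lemma filter_le_anti : antisymmetric filter_le.
Proof.
move=> a b /andP[/asboolP ba /asboolP ab].
by apply: filters_inj; apply/seteqP.
Qed.

Lemma filter_le_trans : transitive filter_le.
Proof.
move=> b a c /asboolP ba /asboolP cb.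
by apply/asboolP; apply: subset_trans cb ba.
Qed.

Lemma filter_top_subproof : @is_filter X [set \top].
Proof.
split; first by exists \top.
- by move=> _ y -> /=; rewrite le1x => /eqP.
- by move=> _ _ -> -> /=; rewrite meetxx.
Qed.

Definition filter_top : filters X := MkFilter filter_top_subproof.

Lemma filter_has_top a : filter_set a \top.
Proof. by have [[x ax] up _] := filter_setP a; apply: up ax _; rewrite lex1. Qed.

Lemma filter_le_top a : filter_le a filter_top.
Proof. by apply/asboolP => _ ->; apply: filter_has_top. Qed.

Lemma filter_meet_subproof a b :
  @is_filter X [set x `&` y | x in filter_set a & y in filter_set b].
Proof.
have [_ upa Ia] := filter_setP a; have [_ upb Ib] := filter_setP b.
split.
- exists (\top `&` \top), \top; first exact: filter_has_top.
  by exists \top => //; apply: filter_has_top.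
- move=> _ z [x ax [y by_ <-]] xyz.
  have [y1 Hy1] := iframe_imp x z; have [x1 Hx1] := iframe_imp y1 z.
  have yy1 : y <= y1 by apply/Hy1; rewrite meetC.
  have xx1 : x <= x1 by apply/Hx1; rewrite meetC; apply/Hy1.
  exists x1; first exact: upa xx1.
  exists y1; first exact: upb yy1.
  apply/le_anti; rewrite lexI.
  have -> : x1 `&` y1 <= z by apply/Hx1.
  by rewrite /=; apply/andP; split; [apply/Hx1|apply/Hy1]; apply: leIl.
- move=> _ _ [x ax [y by_ <-]] [x' ax' [y' by' <-]].
  exists (x `&` x'); first exact: Ia.
  by exists (y `&` y'); [exact: Ib|rewrite meetACA].
Qed.

Definition filter_meet a b : filters X := MkFilter (filter_meet_subproof a b).

Lemma filter_lexI a b c :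
  filter_le a (filter_meet b c) = filter_le a b && filter_le a c.
Proof.
have [_ _ Ia] := filter_setP a.
apply/asboolP/andP => [h|[/asboolP h1 /asboolP h2]].
  split; apply/asboolP => x bx; apply: h.
    by exists x => //; exists \top; [exact: filter_has_top|rewrite meetx1].
  by exists \top; [exact: filter_has_top|exists x => //; rewrite meet1x].
by move=> _ [x /h1 ax [y /h2 ay <-]]; apply: Ia.
Qed.

HB.instance Definition _ := gen_eqMixin (filters X).
HB.instance Definition _ := gen_choiceMixin (filters X).
HB.instance Definition _ := Order.Le_isPOrder.Build msl_display
  (filters X) filter_le_refl filter_le_anti filter_le_trans.
HB.instance Definition _ := Order.POrder_isMeetSemilattice.Build
  msl_display (filters X) filter_lexI.
HB.instance Definition _ :=
  Order.hasTop.Build msl_display (filters X) filter_le_top.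

End FilterSemilattice.

Definition G_obj (X : IF) : MF := filters X : msl.

Lemma filter_image_subproof (X Y : iFrame) (h : X -> Y) (a : filters X) :
  is_iframe_hom h -> @is_filter Y (h @` a).
Proof.
move=> [[h1 hI] hb]; have [[x ax] up Ia] := filter_setP a; split.
- by exists (h x), x.
- by move=> _ y [z az <-] /hb[t zt <-]; exists t => //; apply: up zt.
- by move=> _ _ [y ay <-] [z az <-]; exists (y `&` z); [apply: Ia|apply: hI].
Qed.

Definition filter_image (X Y : IF) (h : hom X Y) (a : filters X) : filters Y :=
  MkFilter (filter_image_subproof a (svalP h)).

Lemma is_msl_hom_filter_image (X Y : IF) (h : hom X Y) :
  @is_msl_hom (G_obj X) (G_obj Y) (filter_image h).
Proof.
have [[h1 hI] _] := svalP h; split=> [|a b]; apply: filters_inj => /=.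
  by rewrite image_set1 h1.
apply/seteqP; split=> [_ [_ [x ax [y by_ <-]] <-]|].
  by exists (sval h x); [exists x|exists (sval h y); [exists y|rewrite hI]].
move=> _ [_ [x ax <-] [_ [y by_ <-] <-]].
by exists (x `&` y); [exists x => //; exists y|apply: hI].
Qed.

Definition G_map (X Y : IF) (h : hom X Y) : hom (G_obj X) (G_obj Y) :=
  exist _ (filter_image h) (is_msl_hom_filter_image h).

Lemma G_map1 (X : IF) : G_map (idm X) = idm (G_obj X).
Proof.
by apply: sval_eq; apply/funext => a; apply: filters_inj; apply: image_id.
Qed.

Lemma G_mapM (X Y Z : IF) (g : hom Y Z) (f : hom X Y) :
  G_map (compm g f) = compm (G_map g) (G_map f).
Proof.
apply: sval_eq; apply/funext => a; apply: filters_inj.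
by rewrite /= image_comp.
Qed.

Definition G : functor IF MF := Functor G_map1 G_mapM.

Record boxFrame := BoxFrame {
  box_iframe :> iFrame;
  box_rel : box_iframe -> box_iframe -> Prop;
  box_B1 : (forall x, box_rel \top x <-> x = \top) /\
           (forall x, box_rel x \top);
  box_B2 : forall x y z : box_iframe, box_rel x y -> y <= z -> box_rel x z;
  box_B3 : forall x x' y y', box_rel x y -> box_rel x' y' ->
    box_rel (x `&` x') (y `&` y');
  box_B4 : forall x x' z, box_rel (x `&` x') z ->
    exists y y', [/\ box_rel x y, box_rel x' y' & y `&` y' = z]
}.

Definition boxframe_sort (X : boxFrame) : Type := X.

Definition is_boxframe_hom (X Y : boxFrame) (h : X -> Y) : Prop :=
  [/\ is_iframe_hom h,
      forall x y : X, box_rel x y -> box_rel (h x) (h y) &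
      forall (x : X) (y' : Y), box_rel (h x) y' ->
        exists2 y : X, box_rel x y & h y = y'].

Lemma is_boxframe_hom_id (X : boxFrame) : @is_boxframe_hom X X id.
Proof. by split=> //; [exact: is_iframe_hom_id|move=> x y xy; exists y]. Qed.

Lemma is_boxframe_hom_comp (X Y Z : boxFrame) (g : Y -> Z) (f : X -> Y) :
  is_boxframe_hom g -> is_boxframe_hom f -> is_boxframe_hom (g \o f).
Proof.
move=> [g1 g2 g3] [f1 f2 f3]; split; first exact: is_iframe_hom_comp.
  by move=> x y /f2/g2.
by move=> x z /g3[_ /f3[y xy <-] <-]; exists y.
Qed.

Definition IF_Box : category :=
  @concrete_category boxFrame boxframe_sort is_boxframe_hom
    is_boxframe_hom_id is_boxframe_hom_comp.

(* Main.v *)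
(* A relation R satisfying (B1)-(B4) is the same thing as a finite-meet-preserving
   map x |-> R[x] into filters: (B2), (B3) and [x R \top] make R[x] a filter, (B1)
   is preservation of the top, and (B3), (B4) are the two inclusions of
   R[x `&` x'] = R[x] `&` R[x'].  Likewise h[R[x]] = R'[h x] is the conjunction of
   the two clauses on [box_rel] for a box-frame morphism. Both translations leave
   the underlying I-frames and functions unchanged. *)
From mathcomp Require Import all_boot all_order.
From mathcomp Require Import boolp classical_sets.
Require Import Defs.

Set Implicit Arguments.
Unset Strict Implicit.
Unset Printing Implicit Defensive.

Import Order.TTheory.
Local Open Scope classical_set_scope.
Local Open Scope order_scope.

(** Both functors share the object map [o], so the types of [m] and [m'] agree without transport.
    The functor laws are propositions, hence only the morphism maps matter. *)
Lemma functor_eq (C D : category) (o : C -> D)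
    (m m' : forall X Y : C, hom X Y -> hom (o X) (o Y)) p q p' q' :
  (forall X Y (f : hom X Y), m X Y f = m' X Y f) ->
  @Functor C D o m p q = @Functor C D o m' p' q'.
Proof.
move=> mm'; have {}mm' : m = m'.
  by do 3![apply: functional_extensionality_dep => ?].
by case: _ / mm' p' q' => p' q'; congr Functor; apply: Prop_irrelevance.
Qed.

Definition faithful (C D : category) (U : functor C D) : Prop :=
  forall (X Y : C) (f g : hom X Y), fmap U f = fmap U g -> f = g.

(* Comparing maps only after applying U avoids transporting them along the
   equalities between objects. *)
Lemma faithful_functor_eq (B C D : category) (U : functor C D)
    (F F' : functor B C) :
  faithful U -> (forall X, F X = F' X) ->
  functor_comp U F = functor_comp U F' -> F = F'.
Proof.
move=> Uf; case: F F' => [o m p q] [o' m' p' q'] /= oo'.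
have {}oo' : o = o' by apply/funext.
case: _ / oo' m' p' q' => m' p' q' UFF'; apply: functor_eq => X Y f; apply: Uf.
pose mapU (K : functor B D) := existT
  (fun k : B -> D => forall X Y : B, hom X Y -> hom (k X) (k Y))
  (fobj K) (@fmap _ _ K).
have := projT2_eq (congr1 mapU UFF').
(* The object maps are already identified, so [e] equates a map with itself. Replacing it by [erefl]
   removes the transport from the equality of second components. *)
set e := projT1_eq _; rewrite (Prop_irrelevance e erefl) /= => h.
exact: (congr1 (fun k => k X Y f) h).
Qed.

Section Dialg_forget.
Variables (C D : category) (F H : functor C D).

Definition Dialg_forget : functor (Dialg F H) C :=
  @Functor (Dialg F H) C (@dialg_obj _ _ F H) (fun _ _ f => sval f)
    (fun=> erefl) (fun _ _ _ _ _ => erefl).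

Lemma Dialg_forget_faithful : faithful Dialg_forget.
Proof. by move=> X Y f g; apply: sval_eq. Qed.

End Dialg_forget.

Definition Box_forget_map (A B : IF_Box) (h : hom A B) :
    @hom IF (box_iframe A) (box_iframe B) :=
  exist _ (sval h) (let: And3 h1 _ _ := svalP h in h1).

Lemma Box_forget_map1 (A : IF_Box) :
  Box_forget_map (idm A) = @idm IF (box_iframe A).
Proof. exact: sval_eq. Qed.

Lemma Box_forget_mapM (A B K : IF_Box) (g : hom B K) (f : hom A B) :
  Box_forget_map (compm g f) =
  @compm IF _ _ _ (Box_forget_map g) (Box_forget_map f).
Proof. exact: sval_eq. Qed.

Definition Box_forget : functor IF_Box IF :=
  @Functor IF_Box IF box_iframe Box_forget_map Box_forget_map1 Box_forget_mapM.

Lemma Box_forget_faithful : faithful Box_forget.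
Proof. by move=> A B f g fg; apply: sval_eq; apply: (congr1 sval fg). Qed.

Section DialgOfBox.
Variable A : boxFrame.

Lemma box_image_subproof (x : A) : is_filter [set y | box_rel x y].
Proof.
split; first by exists \top; apply: (box_B1 A).2.
- by move=> y z; apply: box_B2.
(* Idempotence turns (B3), which meets both arguments, into closure of a single [R[x]] under
   meets. *)
- by move=> y z xy xz; rewrite /= -[x]meetxx; apply: box_B3.
Qed.

Definition box_image (x : A) : filters A := MkFilter (box_image_subproof x).

Lemma is_msl_hom_box_image : @is_msl_hom A (filters A) box_image.
Proof.
split=> [|x y]; apply: filters_inj; apply/seteqP; split=> z /=.
- by move/(box_B1 A).1.
- by move=> ->; apply: (box_B1 A).2.
- by case/box_B4 => u [v [xu yv uv]]; exists u => //; exists v.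
- by case=> u xu [v yv <-]; apply: box_B3.
Qed.

Definition dialg_of_box : dialgebra IF_incl G :=
  @Dialgebra _ _ IF_incl G (box_iframe A) (exist _ box_image is_msl_hom_box_image).

End DialgOfBox.

Section BoxOfDialg.
Variable A : dialgebra IF_incl G.

Let X : iFrame := dialg_obj A.
Let gamma : X -> filters X := sval (dialg_str A).
(** The right-hand sides are the concrete filters to which the top and meet of [G] unfold, so
    rewriting with these equations exposes membership conditions. *)
Let gamma_top : gamma \top = filter_top X := proj1 (svalP (dialg_str A)).
Let gammaI x y : gamma (x `&` y) = filter_meet (gamma x) (gamma y) :=
  proj2 (svalP (dialg_str A)) x y.

Definition dialg_rel (x y : X) : Prop := filter_set (gamma x) y.

Lemma dialg_B1 :
  (forall x, dialg_rel \top x <-> x = \top) /\ (forall x, dialg_rel x \top).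
Proof.
by split=> x; [rewrite /dialg_rel gamma_top|apply: filter_has_top].
Qed.

Lemma dialg_B2 (x y z : X) : dialg_rel x y -> y <= z -> dialg_rel x z.
Proof. by have [_ up _] := filter_setP (gamma x); apply: up. Qed.

Lemma dialg_B3 (x x' y y' : X) :
  dialg_rel x y -> dialg_rel x' y' -> dialg_rel (x `&` x') (y `&` y').
Proof. by move=> xy xy'; rewrite /dialg_rel gammaI; exists y => //; exists y'. Qed.

Lemma dialg_B4 (x x' z : X) : dialg_rel (x `&` x') z ->
  exists y y', [/\ dialg_rel x y, dialg_rel x' y' & y `&` y' = z].
Proof.
by rewrite /dialg_rel gammaI => -[y xy [y' xy' <-]]; exists y, y'.
Qed.

Definition box_of_dialg : boxFrame :=
  BoxFrame dialg_B1 dialg_B2 dialg_B3 dialg_B4.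

End BoxOfDialg.

(** Membership in [box_image x] is [box_rel x] by conversion, so the round trip alters only the
    proofs of (B1)-(B4). *)
Lemma dialg_of_boxK (A : boxFrame) : box_of_dialg (dialg_of_box A) = A.
Proof.
case: A => X R b1 b2 b3 b4.
by rewrite /box_of_dialg; congr BoxFrame; apply: Prop_irrelevance.
Qed.

Lemma box_of_dialgK (A : dialgebra IF_incl G) :
  dialg_of_box (box_of_dialg A) = A.
Proof.
case: A => X g; rewrite /dialg_of_box; congr Dialgebra.
by apply: sval_eq; apply/funext => x; apply: filters_inj.
Qed.

Lemma is_dialg_hom_of_box (A B : IF_Box) (h : hom A B) :
  @is_dialg_hom _ _ IF_incl G (dialg_of_box A) (dialg_of_box B)
    (Box_forget_map h).
Proof.
have [_ hR hback] := svalP h.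
apply: sval_eq; apply/funext => x; apply: filters_inj; apply/seteqP.
(* Preservation of the relation gives the inclusion of [h[R[x]]] in [R'[h x]]; the back condition
   gives the converse. *)
by split=> [_ [y xy <-]|y' /hback[y xy <-]]; [apply: hR|exists y].
Qed.

Lemma is_boxframe_hom_of_dialg (A B : Dialg IF_incl G) (f : hom A B) :
  @is_boxframe_hom (box_of_dialg A) (box_of_dialg B) (sval (sval f)).
Proof.
(* The commuting square of the dialgebra morphism, evaluated at [x] and read as an equality of
   sets. *)
have imageE x : filter_set (sval (dialg_str B) (sval (sval f) x)) =
    sval (sval f) @` filter_set (sval (dialg_str A) x).
  exact/esym/(congr1 (fun k => filter_set (sval k x)) (svalP f)).
split; first exact: (svalP (sval f)).
- by move=> x y xy; rewrite /= /dialg_rel imageE; exists y.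
- by move=> x y'; rewrite /= /dialg_rel imageE => -[y xy <-]; exists y.
Qed.

Definition Dialg_of_Box_map (A B : IF_Box) (h : hom A B) :
    @hom (Dialg IF_incl G) (dialg_of_box A) (dialg_of_box B) :=
  exist _ (Box_forget_map h) (is_dialg_hom_of_box h).

Definition Box_of_Dialg_map (A B : Dialg IF_incl G) (f : hom A B) :
    @hom IF_Box (box_of_dialg A) (box_of_dialg B) :=
  exist _ (sval (sval f)) (is_boxframe_hom_of_dialg f).

Lemma Dialg_of_Box_map1 (A : IF_Box) :
  Dialg_of_Box_map (idm A) = @idm (Dialg IF_incl G) (dialg_of_box A).
Proof. by do 2!apply: sval_eq. Qed.

Lemma Dialg_of_Box_mapM (A B K : IF_Box) (g : hom B K) (f : hom A B) :
  Dialg_of_Box_map (compm g f) =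
  @compm (Dialg IF_incl G) _ _ _ (Dialg_of_Box_map g) (Dialg_of_Box_map f).
Proof. by do 2!apply: sval_eq. Qed.

Definition Dialg_of_Box : functor IF_Box (Dialg IF_incl G) :=
  @Functor IF_Box (Dialg IF_incl G) dialg_of_box Dialg_of_Box_map
    Dialg_of_Box_map1 Dialg_of_Box_mapM.

Lemma Box_of_Dialg_map1 (A : Dialg IF_incl G) :
  Box_of_Dialg_map (idm A) = @idm IF_Box (box_of_dialg A).
Proof. exact: sval_eq. Qed.

Lemma Box_of_Dialg_mapM (A B K : Dialg IF_incl G) (g : hom B K) (f : hom A B) :
  Box_of_Dialg_map (compm g f) =
  @compm IF_Box _ _ _ (Box_of_Dialg_map g) (Box_of_Dialg_map f).
Proof. exact: sval_eq. Qed.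

Definition Box_of_Dialg : functor (Dialg IF_incl G) IF_Box :=
  @Functor (Dialg IF_incl G) IF_Box box_of_dialg Box_of_Dialg_map
    Box_of_Dialg_map1 Box_of_Dialg_mapM.

Theorem theorem4p9 : isomorphic_categories IF_Box (Dialg IF_incl G).
Proof.
exists Dialg_of_Box, Box_of_Dialg; split.
- apply: (faithful_functor_eq Box_forget_faithful) => [A|].
    exact: dialg_of_boxK.
  (* After forgetting to [IF], both functors have convertible object maps and keep the underlying
     function of [h]. *)
  by apply: functor_eq => A B h; apply: sval_eq.
- apply: (faithful_functor_eq (@Dialg_forget_faithful _ _ _ _)) => [A|].
    exact: box_of_dialgK.
  by apply: functor_eq => A B f; apply: sval_eq.
Qed.
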